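(* For every odd integer $n>3$, $n^2\mid (2,3)_n$; for every odd integer $n>5$, $n^2\mid (6,15)_n$.
   Context: For an odd integer $n>1$, $\left(\frac{\cdot}{n}\right)$ denotes the Jacobi symbol. For integers $c,d$, define the integer $$(c,d)_n=\det\left[\left(\frac{j^2+cjk+dk^2}{n}\right)\right]_{1\le j,k\le n-1}.$$ *)

(* Defs.v *)
From mathcomp Require Import all_boot all_order all_algebra.
Set Implicit Arguments.
Unset Strict Implicit.
Unset Printing Implicit Defensive.
Import GRing.Theory.
Local Open Scope ring_scope.

(* Meaningful for p an odd prime. *)
Definition legendre (p : nat) (a : int) : int :=
  if (p%:Z %| a)%Z then 0
  else if [exists x : 'I_p, ((x%:Z) ^+ 2 == a %[mod p%:Z])%Z] then 1
  else - 1.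

(* Meaningful for n odd. *)
Definition jacobi (n : nat) (a : int) : int :=
  \prod_(p <- primes n) legendre p a ^+ logn p n.

(* Ordinals start at 0, whereas the determinant (c,d)_n is indexed by
   1 <= j, k <= n - 1. *)
Definition jacobi_matrix (c d : int) (n : nat) : 'M[int]_(n.-1) :=
  \matrix_(j < n.-1, k < n.-1)
    jacobi n (j.+1%:Z ^+ 2 + c * j.+1%:Z * k.+1%:Z + d * k.+1%:Z ^+ 2).

Definition jacobi_det (c d : int) (n : nat) : int := \det (jacobi_matrix c d n).

(* Main.v *)
Require Import Defs.
From mathcomp Require Import all_boot all_order all_algebra.
From mathcomp Require Import cyclic finfield zify ring.
Set Implicit Arguments.
Unset Strict Implicit.
Unset Printing Implicit Defensive.
Import Order.TTheory GRing.Theory Num.Theory.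
Local Open Scope ring_scope.

(* Let p be a prime divisor of n, h = (p - 1) / 2 and a_i the coefficient of X^i
   in (X^2 + c X + d)^h modulo p.  By Euler's criterion the symbol of
   j^2 + c j k + d k^2 at p is sum_i a_i j^i k^(p - 1 - i) modulo p, so if n is
   squarefree, the matrix modulo p is a sum over the i with a_i <> 0 of matrices
   of rank at most n / p; when n = p the terms i = 0 and i = p - 1 coincide.
   Since h = - 1 / 2 modulo p, the a_i are proportional to values of Legendre
   polynomials: for (2, 3) one has a_2 = a_(p - 3) = 0 because P_2 vanishes at
   1 / sqrt 3, and for (6, 15) one has a_3 = a_(p - 4) = 0 because P_3 vanishes
   at sqrt (3 / 5).  Hence the corank modulo p is at least 2, and p^2 divides the
   determinant by the Smith normal form.  If p divides d and n > p, row p is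
   zero; if n is not squarefree, two rows coincide; the primes 5 for (2, 3) and
   7 for (6, 15), where the two vanishing coefficients are the same one, have
   explicit kernel vectors. *)

(** * Euler's criterion and the Legendre symbol in ['F_p] *)

Lemma intr_Fp_eq0 (p : nat) (a : int) : prime p ->
  (a%:~R == 0 :> 'F_p) = (p%:Z %| a)%Z.
Proof. by move=> p_pr; rewrite -(dvdz_pcharf (pchar_Fp p_pr)). Qed.

Lemma expf_pred_Fp (p : nat) (x : 'F_p) : prime p -> x != 0 -> x ^+ p.-1 = 1.
Proof.
move=> p_pr x0; apply: (mulfI x0); rewrite mulr1 -exprS prednK ?prime_gt0 //.
by have := expf_card x; rewrite card_Fp.
Qed.

Lemma euler_criterion_Fp (p : nat) (x : 'F_p) : prime p -> odd p -> x != 0 ->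
  x ^+ p.-1./2 = if [exists y, y ^+ 2 == x] then 1 else -1.
Proof.
move=> p_pr p_odd x0; have p1 := prime_gt1 p_pr.
have hE : p.-1 = (p.-1./2 * 2)%N by lia.
have h0 : (0 < p.-1./2)%N by have := odd_prime_gt2 p_odd p_pr; lia.
case: ifPn => [/existsP[y /eqP yx]|nsq].
  rewrite -yx -exprM mulnC -hE expf_pred_Fp //.
  by apply: contraNneq x0 => y0; rewrite -yx y0 expr0n.
have: (x ^+ p.-1./2) ^+ 2 == 1 by rewrite -exprM -hE expf_pred_Fp.
rewrite sqrf_eq1 => /orP[] /eqP // xh; case/negP: nsq.
(* The [p.-1] nonzero elements are all roots of [X^(p-1) - 1], so one of them is a primitive
   root. *)
have /hasP[z _ z_prim] : has (p.-1).-primitive_root [seq y <- enum 'F_p | y != 0].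
  apply: has_prim_root; first by lia.
  - apply/allP=> y; rewrite mem_filter => /andP[y0 _].
    by apply/unity_rootP; apply: expf_pred_Fp.
  - by rewrite filter_uniq ?enum_uniq.
  have := cardC1 (0 : 'F_p); rewrite card_Fp // cardE /enum_mem => <-.
  rewrite -filter_predI; apply/eq_leq; congr size.
  by apply: eq_filter => y; rewrite !inE ?andbT.
have [[i /= _] xE] := prim_rootP z_prim (expf_pred_Fp p_pr x0).
have : z ^+ (i * p.-1./2) == 1 by rewrite exprM -xE xh.
rewrite -(prim_order_dvd z_prim).
(* Since [p.-1] is twice [p.-1./2], the divisibility says that [i] is even, and [z ^+ (i / 2)] is a
   square root of [x]. *)
rewrite {1}hE mulnC dvdn_pmul2r // => /dvdnP[k iE].
by apply/existsP; exists (z ^+ k); rewrite -exprM -iE xE.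
Qed.

Lemma legendre_Fp (p : nat) (a : int) : prime p -> odd p ->
  (legendre p a)%:~R = (a%:~R : 'F_p) ^+ p.-1./2.
Proof.
move=> p_pr p_odd; have p2 := odd_prime_gt2 p_odd p_pr.
rewrite /legendre -intr_Fp_eq0 //; case: ifPn => [/eqP->|a0].
  by rewrite expr0n; case: eqP => // h0; lia.
rewrite euler_criterion_Fp //.
suff -> : [exists x : 'I_p, (x%:Z ^+ 2 == a %[mod p])%Z] =
          [exists y : 'F_p, y ^+ 2 == a%:~R] by case: ifP.
apply/existsP/existsP => [[x]|[y /eqP yE]].
  rewrite eqz_mod_dvd -intr_Fp_eq0 // rmorphB rmorphXn subr_eq0 => xa.
  by exists (x%:Z%:~R).
have yp : (val y < p)%N by rewrite -[X in (_ < X)%N](Fp_cast p_pr) ltn_ord.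
exists (Ordinal yp); rewrite eqz_mod_dvd -intr_Fp_eq0 // rmorphB rmorphXn.
by rewrite subr_eq0 /= -yE -[X in _ == X ^+ 2]natr_Zp.
Qed.

Lemma legendre_mod (p : nat) (a b : int) :
  (p%:Z %| a - b)%Z -> legendre p a = legendre p b.
Proof.
rewrite -eqz_mod_dvd => /eqP ab; rewrite /legendre.
have -> : (p%:Z %| a)%Z = (p%:Z %| b)%Z.
  by apply/dvdz_mod0P/dvdz_mod0P; rewrite ab.
by under eq_existsb => x do rewrite ab.
Qed.

(** * Corank modulo p and divisibility of the determinant *)

(** Putting a 1 at each zero of the diagonal makes the matrix invertible, and each such correction
    has rank 1. *)
Lemma mxrank_diag (F : fieldType) (n : nat) (v : 'rV[F]_n) :
  (n <= \rank (diag_mx v) + #|[pred i | v 0%R i == 0%R]|)%N.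
Proof.
pose D i : 'M[F]_n := if v 0 i == 0 then delta_mx i i else 0.
have U : diag_mx v + \sum_i D i \in unitmx.
  pose w := \row_i (if v 0 i == 0 then 1 else v 0 i) : 'rV[F]_n.
  have -> : diag_mx v + \sum_i D i = diag_mx w.
    apply/matrixP=> i j; rewrite !mxE summxE (bigD1 i) //= big1 => [|k ki].
      rewrite addr0 /D; case: (eqVneq (v 0 i) 0) => [->|_].
        by rewrite mul0rn add0r mxE eqxx /= eq_sym.
      by rewrite mxE addr0.
    by rewrite /D; case: ifP => _; rewrite !mxE // (negPf (_ : i != k)) // eq_sym.
  rewrite unitmxE det_diag unitfE prodf_seq_neq0; apply/allP=> i _ /=.
  by rewrite mxE; case: ifPn; rewrite ?oner_eq0.
have := mxrank_add (diag_mx v) (\sum_i D i); rewrite (mxrank_unit U).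
move/leq_trans; apply; rewrite leq_add2l -sum1_card.
rewrite [leqRHS]big_mkcond /=.
elim/big_ind2: _ => [|A x B y Ax By|i _]; first by rewrite mxrank0.
  by apply: leq_trans (mxrank_add _ _) (leq_add Ax By).
by rewrite /D inE; case: ifP => _; rewrite ?mxrank_delta ?mxrank0.
Qed.

(** Unimodular factors stay invertible modulo p, so the corank is at most the number of diagonal
    Smith entries divisible by p; each of them contributes a factor p to the determinant. *)
Lemma dvdz_det_corank (p n : nat) (A : 'M[int]_n) : prime p ->
  (p%:Z ^+ (n - \rank (map_mx intr A : 'M['F_p]_n)) %| \det A)%Z.
Proof.
move=> p_pr; have [L uL [R uR [s _ ->]]] := int_Smith_normal_form A.
pose v := \row_(i < n) s`_i.
have -> : (\matrix_(i, j) (s`_i *+ (i == j :> nat))) = diag_mx v.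
  by apply/matrixP=> i j; rewrite !mxE.
have uF (B : 'M[int]_n) : B \in unitmx -> (map_mx intr B : 'M['F_p]_n) \in unitmx.
  by rewrite !unitmxE det_map_mx; apply: rmorph_unit.
rewrite !map_mxM mxrankMfree ?row_free_unit ?uF // eqmxMfull ?row_full_unit ?uF //.
rewrite map_diag_mx !det_mulmx det_diag dvdz_mulr // dvdz_mull //.
have := mxrank_diag (map_mx intr v : 'rV['F_p]_n).
rewrite -leq_subLR => /(@dvdz_exp2l p%:Z) /dvdz_trans; apply.
have -> : #|[pred i | map_mx intr v 0%R i == 0%R :> 'F_p]| =
          (\sum_(i < n | (p%:Z %| v 0%R i)%Z) 1)%N.
  by rewrite -sum1_card; apply: eq_bigl => i; rewrite inE mxE intr_Fp_eq0.
rewrite [X in (_ %| X)%Z](bigID (fun i => p%:Z %| v 0%R i)%Z) /= dvdz_mulr //.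
elim/big_rec2: _ => [|i x y iP]; rewrite ?expr0 //.
by rewrite add1n exprS; apply: dvdz_mul.
Qed.

(** * Coefficients of a power of a quadratic polynomial *)

Definition quadratic_exp (R : comNzRingType) (c d : R) (h : nat) : {poly R} :=
  ('X^2 + c *: 'X + d%:P) ^+ h.

Section QuadraticExp.
Variables (R : comNzRingType) (c d : R) (h : nat).
Local Notation a := (quadratic_exp c d h).

Let q : {poly R} := 'X^2 + c *: 'X + d%:P.

Let size_q : size q = 3%N.
Proof.
rewrite /q -addrA size_polyDl size_polyXn // (leq_ltn_trans (size_polyD _ _)) //.
rewrite gtn_max (leq_ltn_trans (size_scale_leq _ _)) ?size_polyX //.
by rewrite (leq_ltn_trans (size_polyC_leq1 _)).
Qed.

Let q_monic : q \is monic.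
Proof. by rewrite monicE /lead_coef size_q !coefE /= mulr0 !addr0. Qed.

Lemma size_quadratic_exp : size a = h.*2.+1.
Proof.
rewrite /quadratic_exp -/q; elim: h => [|k IH]; first by rewrite expr0 size_poly1.
rewrite exprS size_monicM // ?IH ?size_q //.
by rewrite monic_neq0 // monic_exp.
Qed.

Lemma quadratic_exp_lead : a`_h.*2 = 1.
Proof.
have /monicP := monic_exp h q_monic.
by rewrite /lead_coef size_quadratic_exp.
Qed.

(* Comparing coefficients in q (q ^ h)' = h q' q ^ h for q = X^2 + c X + d. *)
Let ode : q * a^`() = (q^`() * a) *+ h.
Proof.
rewrite /quadratic_exp -/q deriv_exp; case: h => [|k]; first by rewrite !mulr0n mulr0.
rewrite mulrnAr; congr (_ *+ _). rewrite exprS. ring.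
Qed.


(** This says h = -1/2 in [R], as for h = (p - 1) / 2 in characteristic p. *)
Hypothesis h2 : (h.*2.+1)%:R = 0 :> R.

Let h2' : 2 * h%:R + 1 = 0 :> R.
Proof. move: h2; rewrite -natr1 -mul2n. by rewrite natrM. Qed.

Lemma quadratic_exp_rec0 : 2 * d * a`_1 + c * a`_0 = 0.
Proof.
have E := congr1 (coefp 0) ode.
rewrite /= /q !derivE !mulrDl !(coefD, coefMn) -!scalerAl !coefZ in E.
rewrite !(coefXnM, coefXM, coefCM) /= coef_deriv mul1r in E.
rewrite !(add0r, mulr0, mul0r, addr0, mulr1n) in E.
have -> : 2 * d * a`_1 + c * a`_0 = 2 * (d * a`_1 - c * a`_0 *+ h)
  + (2 * h%:R + 1) * (c * a`_0) by ring.
by rewrite h2' E subrr mul0r mulr0 addr0.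
Qed.

(** Twice the coefficient of X^(n+1) in [ode], with 2h replaced by -1; up to scaling this is
    Bonnet's recurrence for Legendre polynomials. *)
Lemma quadratic_exp_rec n :
  2 * d * n.+2%:R * a`_n.+2 + c * (2 * n%:R + 3) * a`_n.+1
  + 2 * (n%:R + 1) * a`_n = 0.
Proof.
have E := congr1 (coefp n.+1) ode.
rewrite /= /q !derivE !mulrDl !(coefD, coefMn) -!scalerAl !coefZ in E.
rewrite !(coefXnM, coefXM, coefCM) /= !coef_deriv mul1r in E.
have nE : (if (n.+1 < 2)%N then 0 else a`_(n.+1 - 2).+1 *+ (n.+1 - 2).+1)
          = a`_n *+ n.
  by case: n {E} => //= n; rewrite !subSS subn0.
rewrite {}nE subn1 mul0r addr0 /= in E.
have -> : 2 * d * n.+2%:R * a`_n.+2 + c * (2 * n%:R + 3) * a`_n.+1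
  + 2 * (n%:R + 1) * a`_n
  = 2 * (a`_n *+ n + c * (a`_n.+1 *+ n.+1) + d * (a`_n.+2 *+ n.+2)
         - (a`_n + a`_n + c * a`_n.+1) *+ h)
    + (2 * h%:R + 1) * (c * a`_n.+1 + 2 * a`_n).
  by ring.
by rewrite E subrr h2' mul0r mulr0 addr0.
Qed.

End QuadraticExp.

(** * Vanishing coefficients near both ends *)

Section VanishingCoefficients.
Variables (F : fieldType) (h : nat).
Hypothesis h2 : (h.*2.+1)%:R = 0 :> F.

Variables (c d : F).
Local Notation a := (quadratic_exp c d h).

Let rec_top k : (k < h.*2)%N ->
  2 * d * (1 - k.+1%:R) * a`_(h.*2 - k).+1
  - c * (2 * k.+1%:R - 1) * a`_(h.*2 - k)
  - 2 * k.+1%:R * a`_(h.*2 - k.+1) = 0 :> F.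
Proof.
move=> kh; have := quadratic_exp_rec c d h2 (h.*2 - k.+1).
have nE : (h.*2 - k.+1)%:R = - 1 - k.+1%:R :> F.
  rewrite natrB //; apply/eqP; rewrite -subr_eq0 -[X in _ == X]h2 -natr1.
  by apply/eqP; ring.
rewrite -[(_ - _).+2%:R]natr1 -[(_ - _).+1%:R]natr1 nE subnSK // => E.
by rewrite -[RHS]E; ring.
Qed.

Let top1 : (0 < h)%N -> 2 * a`_(h.*2 - 1) = - c * a`_h.*2.
Proof.
move=> h0; have := @rec_top 0 ltac:(lia).
(* The coefficient at 2h + 1 lies beyond the degree. *)
rewrite subn0 nth_default ?size_quadratic_exp // => T.
by apply/eqP; rewrite eq_sym -subr_eq0 -[X in _ == X]T; apply/eqP; ring.
Qed.

Let top2 : (0 < h)%N ->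
  4 * a`_(h.*2 - 2) = - 2 * d * a`_h.*2 - 3 * c * a`_(h.*2 - 1).
Proof.
move=> h0; have := @rec_top 1 ltac:(lia).
rewrite subnSK ?double_gt0 // subn0 => T.
by apply/eqP; rewrite eq_sym -subr_eq0 -[X in _ == X]T; apply/eqP; ring.
Qed.

Let top3 : (1 < h)%N ->
  6 * a`_(h.*2 - 3) = - 4 * d * a`_(h.*2 - 1) - 5 * c * a`_(h.*2 - 2).
Proof.
move=> h0; have := @rec_top 2 ltac:(lia).
rewrite subnSK; last by lia.
move=> T.
by apply/eqP; rewrite eq_sym -subr_eq0 -[X in _ == X]T; apply/eqP; ring.
Qed.

Let low1 : 2 * d * a`_1 = - c * a`_0.
Proof.
apply/eqP; rewrite -subr_eq0 -[X in _ == X](quadratic_exp_rec0 c d h2).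
by apply/eqP; ring.
Qed.

Let low2 : 4 * d * a`_2 = - 3 * c * a`_1 - 2 * a`_0.
Proof.
apply/eqP; rewrite -subr_eq0 -[X in _ == X](quadratic_exp_rec c d h2 0).
by apply/eqP; ring.
Qed.

Let low3 : 6 * d * a`_3 = - 5 * c * a`_2 - 4 * a`_1.
Proof.
apply/eqP; rewrite -subr_eq0 -[X in _ == X](quadratic_exp_rec c d h2 1).
by apply/eqP; ring.
Qed.

Hypotheses (two_neq0 : 2%:R != 0 :> F) (d_neq0 : d != 0).

(* Up to normalization a_k is the Legendre polynomial P_k at - c / (2 sqrt d);
   the condition says that P_2 vanishes there, and similarly for P_3 below. *)
Lemma quadratic_exp_coef2_eq0 : 3 * c ^+ 2 = 4 * d -> (0 < h)%N ->
  a`_2 = 0 /\ a`_(h.*2 - 2) = 0.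
Proof.
move=> cd h0; split.
  (* This factor clears the denominators of [low1] and [low2]; the product is (3c^2 - 4d) a_0. *)
  apply: (mulfI (_ : 2 ^+ 3 * d ^+ 2 != 0)).
    by rewrite !mulf_neq0 ?expf_neq0.
  have -> : 2 ^+ 3 * d ^+ 2 * a`_2 = 2 * d * (4 * d * a`_2) by ring.
  rewrite low2.
  have -> : 2 * d * (- 3 * c * a`_1 - 2 * a`_0)
    = - 3 * c * (2 * d * a`_1) - 4 * d * a`_0 by ring.
  by rewrite low1 -cd; ring.
apply: (mulfI (_ : 2 ^+ 3 != 0)); first by rewrite expf_neq0.
have -> : 2 ^+ 3 * a`_(h.*2 - 2) = 2 * (4 * a`_(h.*2 - 2)) by ring.
rewrite top2 //.
have -> : 2 * (- 2 * d * a`_h.*2 - 3 * c * a`_(h.*2 - 1))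
  = - (4 * d) * a`_h.*2 - 3 * c * (2 * a`_(h.*2 - 1)) by ring.
by rewrite top1 // -cd; ring.
Qed.

Lemma quadratic_exp_coef3_eq0 : 3%:R != 0 :> F -> 5 * c ^+ 2 = 12 * d ->
  (1 < h)%N -> a`_3 = 0 /\ a`_(h.*2 - 3) = 0.
Proof.
move=> n3 cd h1; have h0 := ltnW h1; split.
  (* After clearing denominators the product is -3c (5c^2 - 12d) a_0; the coefficient at 2h - 3
     gives the same multiple of a_(2h). *)
  apply: (mulfI (_ : 2 ^+ 4 * 3 * d ^+ 3 != 0)).
    by rewrite !mulf_neq0 ?expf_neq0.
  have -> : 2 ^+ 4 * 3 * d ^+ 3 * a`_3 = 8 * d ^+ 2 * (6 * d * a`_3) by ring.
  rewrite low3.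
  have -> : 8 * d ^+ 2 * (- 5 * c * a`_2 - 4 * a`_1)
    = - 10 * c * d * (4 * d * a`_2) - 16 * d * (2 * d * a`_1) by ring.
  rewrite low2.
  have -> : - 10 * c * d * (- 3 * c * a`_1 - 2 * a`_0) - 16 * d * (2 * d * a`_1)
    = (3 * (5 * c ^+ 2) - 16 * d) * (2 * d * a`_1) + 20 * c * d * a`_0 by ring.
  by rewrite low1 cd; ring.
apply: (mulfI (_ : 2 ^+ 4 * 3 != 0)); first by rewrite !mulf_neq0 ?expf_neq0.
have -> : 2 ^+ 4 * 3 * a`_(h.*2 - 3) = 8 * (6 * a`_(h.*2 - 3)) by ring.
rewrite top3 //.
have -> : 8 * (- 4 * d * a`_(h.*2 - 1) - 5 * c * a`_(h.*2 - 2))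
  = - 10 * c * (4 * a`_(h.*2 - 2)) - 16 * d * (2 * a`_(h.*2 - 1)) by ring.
rewrite top2 //.
have -> : - 10 * c * (- 2 * d * a`_h.*2 - 3 * c * a`_(h.*2 - 1))
   - 16 * d * (2 * a`_(h.*2 - 1))
  = 20 * c * d * a`_h.*2
    + (3 * (5 * c ^+ 2) - 16 * d) * (2 * a`_(h.*2 - 1)) by ring.
by rewrite top1 // cd; ring.
Qed.

End VanishingCoefficients.

Lemma quadratic_form_exp (F : fieldType) (c d x y : F) (h : nat) :
  (x ^+ 2 + c * x * y + d * y ^+ 2) ^+ h =
  \sum_(i < h.*2.+1) (quadratic_exp c d h)`_i * x ^+ i * y ^+ (h.*2 - i).
Proof.
(* At y = 0 only the term i = 2h survives, through 0^0 = 1; otherwise the polynomial is evaluated at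
   x / y. *)
have [->|y0] := eqVneq y 0.
  rewrite big_ord_recr /= big1 => [|i _]; last first.
    by rewrite expr0n subn_eq0 leqNgt ltn_ord mulr0.
  rewrite quadratic_exp_lead subnn add0r mul1r mulr1 mulr0 expr0n mulr0 !addr0.
  by rewrite -exprM mul2n.
have -> : x ^+ 2 + c * x * y + d * y ^+ 2
        = y ^+ 2 * ('X^2 + c *: 'X + d%:P).[x / y].
  by rewrite !hornerD hornerXn hornerZ hornerX hornerC; field.
rewrite exprMn -horner_exp -/(quadratic_exp c d h).
rewrite (@horner_coef_wide _ h.*2.+1) ?size_quadratic_exp // mulr_sumr.
apply: eq_bigr => i _; have ih : (i <= h.*2)%N by rewrite -ltnS.
have -> : (y ^+ 2) ^+ h = y ^+ (h.*2 - i) * y ^+ i.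
  by rewrite -exprD subnK // -exprM mul2n.
rewrite expr_div_n mulrCA mulrACA divff ?expf_neq0 // mulr1 mulrA.
exact: mulrAC.
Qed.

(** * Periodicity of the Jacobi symbol and zero determinants *)

Definition jacobi_cofactor (p n : nat) (a : int) : int :=
  \prod_(q <- primes n | q != p) legendre q a ^+ logn q n.

Lemma jacobiE (p n : nat) (a : int) : p \in primes n ->
  jacobi n a = legendre p a ^+ logn p n * jacobi_cofactor p n a.
Proof. by move=> pn; rewrite /jacobi (bigD1_seq p) ?primes_uniq. Qed.

(** A prime divisor of n other than p still divides n / p. *)
Lemma jacobi_cofactor_mod (p n : nat) (a b : int) :
  p \in primes n -> ((n %/ p)%:Z %| a - b)%Z ->
  jacobi_cofactor p n a = jacobi_cofactor p n b.
Proof.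
rewrite mem_primes => /and3P[p_pr n0 pn] ab.
rewrite /jacobi_cofactor big_seq_cond [RHS]big_seq_cond.
apply: eq_bigr => q /andP[]; rewrite mem_primes => /and3P[q_pr _ qn] qp.
congr (_ ^+ _); apply: legendre_mod; apply: dvdz_trans ab.
rewrite dvdzE /= -(@Gauss_dvdr q p); last by rewrite prime_coprime ?dvdn_prime2.
by rewrite mulnC divnK.
Qed.

(** When p^2 divides n, p itself also divides n / p, so the whole symbol has period n / p. *)
Lemma jacobi_mod (p n : nat) (a b : int) :
  p \in primes n -> (1 < logn p n)%N -> ((n %/ p)%:Z %| a - b)%Z ->
  jacobi n a = jacobi n b.
Proof.
move=> pP; move: (pP); rewrite mem_primes => /and3P[p_pr n0 pn] lpn ab.
rewrite !(jacobiE _ pP) (jacobi_cofactor_mod pP ab).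
congr (_ ^+ _ * _); apply: legendre_mod; apply: dvdz_trans ab.
by rewrite dvdzE /= -(dvdn_pmul2r (prime_gt0 p_pr)) divnK // mulnn pfactor_dvdn.
Qed.

Lemma quadratic_form_mod (c d x x' y : int) (m : nat) : (m%:Z %| x - x')%Z ->
  (m%:Z %| (x ^+ 2 + c * x * y + d * y ^+ 2)
          - (x' ^+ 2 + c * x' * y + d * y ^+ 2))%Z.
Proof.
have -> : (x ^+ 2 + c * x * y + d * y ^+ 2) - (x' ^+ 2 + c * x' * y + d * y ^+ 2)
  = (x - x') * (x + x' + c * y) by ring.
exact: dvdz_mulr.
Qed.

Lemma jacobi_det_eq0_nonsquarefree (c d : int) (p n : nat) :
  odd n -> p \in primes n -> (1 < logn p n)%N -> jacobi_det c d n = 0.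
Proof.
move=> n_odd pP lpn; move: (pP); rewrite mem_primes => /and3P[p_pr n0 pn].
have nE := divnK pn; set m := (n %/ p)%N in nE.
have p_odd : odd p by apply: dvdn_odd pn n_odd.
have p2 := odd_prime_gt2 p_odd p_pr.
have m0 : (0 < m)%N by rewrite divn_gt0 ?prime_gt0 // dvdn_leq.
have n1 : (0 < n.-1)%N by nia.
have mn : (m < n.-1)%N by nia.
(* Row indices 0 and m stand for j = 1 and j = m + 1, which agree modulo m = n / p. *)
apply: (determinant_alternate (i1 := Ordinal n1) (i2 := Ordinal mn)).
  by apply/eqP => /(congr1 val) /=; lia.
move=> k; rewrite !mxE; apply: (jacobi_mod pP lpn).
apply: quadratic_form_mod; rewrite /= -/m.
rewrite (_ : _ - _ = - m%:Z); first by rewrite dvdzE abszN.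
by rewrite intS; ring.
Qed.

Lemma jacobi_det_eq0_dvd (c d : int) (p n : nat) :
  prime p -> (p %| n)%N -> (p < n)%N -> (p%:Z %| d)%Z -> jacobi_det c d n = 0.
Proof.
move=> p_pr pn ltpn pd; have p0 := prime_gt0 p_pr.
have pP : p \in primes n by rewrite mem_primes p_pr pn; lia.
(* The row j = p has index [p.-1]. *)
have pn1 : (p.-1 < n.-1)%N by lia.
rewrite /jacobi_det (expand_det_row _ (Ordinal pn1)) big1 // => k _.
rewrite mxE (jacobiE _ pP) /legendre /= prednK // ifT; last first.
  by rewrite !rpredD // dvdz_mulr // -?expr2 ?dvdz_mull ?dvdz_exp // ?dvdzz.
by rewrite expr0n lognE p_pr pn (leq_ltn_trans _ ltpn) //= !mul0r.
Qed.

(** * Rank of the Jacobi matrix modulo p *)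

(** The cofactor depends on j only modulo m = n / p, so each monomial term factors through the m
    residues. The coefficients [b] are left free to allow both the original expansion and the one
    with merged ends. *)
Lemma mxrank_jacobi_Fp (c d : int) (p n : nat) (b : nat -> 'F_p) :
  prime p -> odd p -> (p %| n)%N -> logn p n = 1%N ->
  (forall j k : 'I_n.-1, let x : 'F_p := j.+1%:R in let y : 'F_p := k.+1%:R in
    (x ^+ 2 + c%:~R * x * y + d%:~R * y ^+ 2) ^+ p.-1./2 =
    \sum_(i < p) b i * x ^+ i * y ^+ (p.-1 - i)) ->
  (\rank (map_mx intr (jacobi_matrix c d n) : 'M['F_p]_n.-1)
    <= n %/ p * #|[pred i : 'I_p | b i != 0%R]|)%N.
Proof.
move=> p_pr p_odd pn lpn bE; set m := (n %/ p)%N.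
have n0 : (0 < n)%N by case: n pn lpn {bE m} => //; rewrite logn0.
have pP : p \in primes n by rewrite mem_primes p_pr pn n0.
have m0 : (0 < m)%N by rewrite divn_gt0 ?prime_gt0 // dvdn_leq.
pose f (x y : int) := x ^+ 2 + c * x * y + d * y ^+ 2.
pose U (i : 'I_p) : 'M['F_p]_(n.-1, m) :=
  \matrix_(j, t) (b i * (j.+1%:R) ^+ i *+ (t == j.+1 %% m :> nat)%N).
pose V (i : 'I_p) : 'M['F_p]_(m, n.-1) :=
  \matrix_(t, k) ((k.+1%:R) ^+ (p.-1 - i)
                  * (jacobi_cofactor p n (f t k.+1))%:~R).
have -> : map_mx intr (jacobi_matrix c d n) = \sum_i U i *m V i.
  apply/matrixP=> j k; rewrite !mxE summxE.
  pose t := Ordinal (ltn_pmod j.+1 m0).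
  transitivity (\sum_i U i j t * V i t k); last first.
    apply: eq_bigr => i _; rewrite [RHS]mxE (bigD1 t) //= big1 ?addr0 // => s st.
    by rewrite !mxE (_ : _ == _ = false) ?mulr0n ?mul0r //; apply: contraNF st.
  rewrite (jacobiE _ pP) lpn expr1 rmorphM /= legendre_Fp //.
  rewrite !(rmorphD, rmorphM, rmorphXn) /= bE mulr_suml.
  apply: eq_bigr => i _; rewrite !mxE eqxx mulr1n [RHS]mulrA; congr (_ * _%:~R).
  apply: jacobi_cofactor_mod => //; apply: quadratic_form_mod.
  by rewrite -eqz_mod_dvd -/m /= !modz_nat modn_mod.
rewrite -sum1_card big_distrr /= [leqRHS]big_mkcond /=.
elim/big_ind2: _ => [|A x B y Ax By|i _]; first by rewrite mxrank0.
  by apply: leq_trans (mxrank_add _ _) (leq_add Ax By).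
rewrite inE muln1; case: eqP => [bi|_] /=; last exact: mulmx_max_rank.
rewrite (_ : U i = 0) ?mul0mx ?mxrank0 //.
by apply/matrixP=> j t; rewrite !mxE bi mul0r mul0rn.
Qed.

(** One vanishing coefficient bounds the rank by m (p - 1) with m = n / p, so the corank is at least
    m - 1, and m is odd and greater than 1. *)
Lemma sqr_dvdz_jacobi_det_composite (c d : int) (p n i : nat) :
  prime p -> odd n -> (p %| n)%N -> logn p n = 1%N -> (p < n)%N -> (i < p)%N ->
  (quadratic_exp (c%:~R : 'F_p) d%:~R p.-1./2)`_i = 0 ->
  (p%:Z ^+ 2 %| jacobi_det c d n)%Z.
Proof.
move=> p_pr n_odd pn lpn ltpn ip ai.
have p_odd : odd p by apply: dvdn_odd pn n_odd.
have p2 := odd_prime_gt2 p_odd p_pr.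
apply: dvdz_trans (dvdz_det_corank (jacobi_matrix c d n) p_pr).
apply: dvdz_exp2l.
have /= := @mxrank_jacobi_Fp c d p n
  (fun i => (quadratic_exp (c%:~R : 'F_p) d%:~R p.-1./2)`_i) p_pr p_odd pn lpn.
have hE : (p.-1./2.*2 = p.-1)%N by lia.
move=> /(_ _)/leq_trans; set r := \rank _ => H.
have : (r <= n %/ p * p.-1)%N.
  apply: H => [j k|].
    by rewrite quadratic_form_exp hE prednK ?prime_gt0.
  rewrite leq_mul2l; apply/orP; right.
  rewrite -[X in (_ <= X.-1)%N]card_ord -(cardC1 (Ordinal ip)); apply/subset_leq_card.
  apply/subsetP=> k; rewrite !inE; apply: contraNneq => ->; by rewrite /= ai.
have := divnK pn; set m := (n %/ p)%N => nE.
have m_odd : odd m by apply: dvdn_odd n_odd; rewrite -nE dvdn_mulr.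
have : m != 1%N by apply: contraTneq ltpn => m1; rewrite -nE m1 mul1n ltnn.
have : (m * p.-1 + m)%N = n by rewrite -mulnSr prednK ?prime_gt0.
clear -m_odd; lia.
Qed.

(** Both end terms are constant when x^(p-1) = y^(p-1) = 1, so they merge into the last one, freeing
    index 0. *)
Lemma sum_merge_ends (R : comPzRingType) (a : nat -> R) (p : nat) (x y : R) :
  (1 < p)%N -> x ^+ p.-1 = 1 -> y ^+ p.-1 = 1 ->
  \sum_(i < p) a i * x ^+ i * y ^+ (p.-1 - i) =
  \sum_(i < p) (if i == 0%N :> nat then 0 else
                if i == p.-1 :> nat then a 0%N + a p.-1 else a i)
               * x ^+ i * y ^+ (p.-1 - i).
Proof.
case: p => [|[|q]] //= _ xq yq.
rewrite [LHS]big_ord_recr [RHS]big_ord_recr /= !big_ord_recl /= subn0 subnn.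
rewrite xq yq eqxx !expr0 !mulr1 add0r addrAC addrC; congr (_ + _).
by apply: eq_bigr => s _; rewrite /= /bump /= add1n eqSS (ltn_eqF (ltn_ord s)).
Qed.

Lemma sqr_dvdz_jacobi_det_prime (c d : int) (p i j : nat) :
  prime p -> odd p -> (0 < i < p.-1)%N -> (0 < j < p.-1)%N -> i != j ->
  (quadratic_exp (c%:~R : 'F_p) d%:~R p.-1./2)`_i = 0 ->
  (quadratic_exp (c%:~R : 'F_p) d%:~R p.-1./2)`_j = 0 ->
  (p%:Z ^+ 2 %| jacobi_det c d p)%Z.
Proof.
move=> p_pr p_odd ip jp ij ai aj.
set a := quadratic_exp _ _ _ in ai aj.
pose b (k : nat) : 'F_p :=
  if k == 0%N then 0 else if k == p.-1 then a`_0 + a`_p.-1 else a`_k.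
apply: dvdz_trans (dvdz_det_corank (jacobi_matrix c d p) p_pr).
apply: dvdz_exp2l.
have hE : (p.-1./2.*2 = p.-1)%N by lia.
have lpp : logn p p = 1%N by rewrite logn_prime // eqxx.
have := @mxrank_jacobi_Fp c d p p b p_pr p_odd (dvdnn p) lpp.
rewrite divnn prime_gt0 // mul1n; set r := \rank _ => H.
have i_lt : (i < p)%N by lia.
have j_lt : (j < p)%N by lia.
(* Three of the p terms vanish, so the rank is at most p - 3 in a matrix of size p - 1. *)
pose Z := [:: Ordinal (prime_gt0 p_pr); Ordinal i_lt; Ordinal j_lt].
have {H} : (r <= #|[predC Z]|)%N.
  apply: leq_trans (H _) _ => {H} [k l|].
    rewrite /= quadratic_form_exp hE -/a.
    have xp (s : 'I_p.-1) : (s.+1%:R : 'F_p) ^+ p.-1 = 1.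
      apply: expf_pred_Fp => //; have := intr_Fp_eq0 s.+1 p_pr => /= ->.
      by rewrite dvdzE /= gtnNdvd //; have := ltn_ord s; lia.
    by rewrite prednK ?prime_gt0 // (sum_merge_ends (nth 0 a)) ?prime_gt1.
  apply/subset_leq_card; apply/subsetP=> k; rewrite !inE.
  have bE0 m : (0 < m < p.-1)%N -> b m = a`_m.
    by rewrite /b => /andP[/gtn_eqF-> /ltn_eqF->].
  apply: contraNN => /or3P[] /eqP -> /=; first by rewrite /b.
    by rewrite bE0 // ai.
  by rewrite bE0 // aj.
have Z_uniq : uniq Z by rewrite /= !inE -!val_eqE /=; lia.
have := cardC (mem Z); rewrite card_ord (card_uniqP Z_uniq) [size _]/=.
by move=> ZE rZ; have {}ZE : (3 + #|[predC Z]| = p)%N := ZE; lia.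
Qed.

(** * Combination over the prime divisors of n *)

Lemma sqr_dvdz_primes (n : nat) (D : int) : (0 < n)%N ->
  (forall p, p \in primes n -> logn p n = 1%N) ->
  (forall p, p \in primes n -> (p%:Z ^+ 2 %| D)%Z) -> (n%:Z ^+ 2 %| D)%Z.
Proof.
move=> n0 sqf Dp; rewrite dvdzE abszX /=.
apply/dvdn_partP; first by rewrite expn_gt0 n0.
move=> p; rewrite -[p \in _]/(p \in primes _) primesX // => pP.
by have := Dp p pP; rewrite p_part lognX sqf.
Qed.

(** One vanishing coefficient per prime suffices for composite n; prime n calls for two, or for a
    direct computation, and is kept as a separate hypothesis. *)
Lemma sqr_dvdz_jacobi_det (c d : int) (n : nat) : odd n -> (1 < n)%N ->
  (forall p, prime p -> (p %| n)%N -> (p < n)%N -> (p%:Z %| d)%Z \/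
     exists2 i, (i < p)%N & (quadratic_exp (c%:~R : 'F_p) d%:~R p.-1./2)`_i = 0) ->
  (prime n -> (n%:Z ^+ 2 %| jacobi_det c d n)%Z) ->
  (n%:Z ^+ 2 %| jacobi_det c d n)%Z.
Proof.
move=> n_odd n1 H Hn; have [/Hn //|n_npr] := boolP (prime n).
have n0 := ltnW n1.
have [/allP sqf|/allPn[p pP lp]] := boolP (all (fun p => logn p n == 1%N) (primes n)).
  apply: sqr_dvdz_primes => // [p /sqf/eqP //|p pP].
  have /eqP lp := sqf p pP; move: pP; rewrite mem_primes => /and3P[p_pr _ pn].
  have ltpn : (p < n)%N.
    rewrite ltn_neqAle dvdn_leq // andbT.
    by apply: contraNneq n_npr => <-.
  have [pd|[i ip ai]] := H p p_pr pn ltpn.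
    by rewrite (jacobi_det_eq0_dvd c p_pr pn ltpn pd) dvdz0.
  exact: sqr_dvdz_jacobi_det_composite ai.
rewrite (jacobi_det_eq0_nonsquarefree c d n_odd pP) ?dvdz0 //.
by rewrite ltn_neqAle eq_sym lp logn_gt0.
Qed.

(** * The exceptional primes 5 and 7 *)

Lemma jacobi_prime (p : nat) (a : int) : prime p -> jacobi p a = legendre p a.
Proof.
by move=> p_pr; rewrite /jacobi primes_prime // big_seq1 logn_prime // eqxx expr1.
Qed.

(** A search through a list replaces the quantifier over ['I_p], so that [vm_compute] can evaluate
    the symbol. *)
Lemma legendre_has (p : nat) (a : int) :
  legendre p a = if (p%:Z %| a)%Z then 0 else
    if has (fun x : nat => (x%:Z ^+ 2 == a %[mod p])%Z) (iota 0 p) then 1 else -1.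
Proof.
rewrite /legendre; suff -> : [exists x : 'I_p, (x%:Z ^+ 2 == a %[mod p])%Z] =
  has (fun x : nat => (x%:Z ^+ 2 == a %[mod p])%Z) (iota 0 p) by [].
apply/existsP/hasP => [[x xa]|[x]].
  by exists (val x) => //; rewrite mem_iota /= add0n.
by rewrite mem_iota add0n => xp xa; exists (Ordinal xp).
Qed.

Lemma det_eq0_mulmx (R : idomainType) (n : nat) (A : 'M[R]_n) (v : 'cV[R]_n) :
  v != 0 -> A *m v = 0 -> \det A = 0.
Proof.
move=> v0 Av; apply: contraNeq v0 => A0.
apply/eqP/matrixP=> i j; apply: (mulfI A0).
have : \det A *: v = 0 by rewrite -mul_scalar_mx -mul_adj_mx -mulmxA Av mulmx0.
by move/matrixP/(_ i j); rewrite !mxE mulr0.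
Qed.

Lemma jacobi_det_2_3_5 : jacobi_det 2 3 5 = 0.
Proof.
(* With k = tj modulo 5, each row sum is the sum of the symbols of 1 + 2t + 3t^2 for t = 1, ..., 4,
   namely 1 - 1 + 1 - 1. *)
apply: (@det_eq0_mulmx _ _ _ (const_mx 1)).
  by apply/eqP => /matrixP /(_ ord0 ord0); rewrite !mxE.
apply/matrixP=> i j; rewrite !mxE.
under eq_bigr => k _ do rewrite !mxE jacobi_prime // legendre_has.
rewrite !big_ord_recl big_ord0.
by case: i => [[|[|[|[|//]]]] ?]; vm_compute.
Qed.

Lemma jacobi_det_6_15_7 : jacobi_det 6 15 7 = 0.
Proof.
(* Modulo 7 the entries are k^3, and summing over k isolates the vanishing a_3; a sum of six terms
   among -1, 0, 1 that is divisible by 7 is zero. *)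
apply: (@det_eq0_mulmx _ _ _ (\col_k legendre 7 k.+1)).
  by apply/eqP => /matrixP /(_ ord0 ord0); rewrite !mxE legendre_has.
apply/matrixP=> i j; rewrite !mxE.
under eq_bigr => k _ do rewrite !mxE jacobi_prime // !legendre_has.
rewrite !big_ord_recl big_ord0.
by case: i => [[|[|[|[|[|[|//]]]]]] ?]; vm_compute.
Qed.

(** * The pairs (2, 3) and (6, 15) *)

Lemma natr_Fp_neq0 (p k : nat) : prime p -> (0 < k < p)%N -> k%:R != 0 :> 'F_p.
Proof.
move=> p_pr /andP[k0 kp]; have := intr_Fp_eq0 k p_pr => /= ->.
by rewrite dvdzE /= gtnNdvd.
Qed.

Lemma natr_Fp_half (p : nat) : prime p -> odd p -> (p.-1./2.*2.+1)%:R = 0 :> 'F_p.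
Proof.
move=> p_pr p_odd; have -> : p.-1./2.*2.+1 = p by have := prime_gt0 p_pr; lia.
exact: pchar_Fp_0.
Qed.

Lemma coef_2_3 (p : nat) : prime p -> odd p -> (3 < p)%N ->
  let a := quadratic_exp ((2 : int)%:~R : 'F_p) (3 : int)%:~R p.-1./2 in
  a`_2 = 0 /\ a`_(p.-1 - 2) = 0.
Proof.
move=> p_pr p_odd p3 a; have hE : p.-1 = p.-1./2.*2 by clear a; lia.
suff: a`_2 = 0 /\ a`_(p.-1./2.*2 - 2) = 0 by rewrite -hE.
apply: quadratic_exp_coef2_eq0.
- exact: natr_Fp_half.
- by apply: natr_Fp_neq0 => //; lia.
- exact: natr_Fp_neq0.
- by ring.
- by clear a; lia.
Qed.

Lemma coef_6_15 (p : nat) : prime p -> odd p -> (5 < p)%N ->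
  let a := quadratic_exp ((6 : int)%:~R : 'F_p) (15 : int)%:~R p.-1./2 in
  a`_3 = 0 /\ a`_(p.-1 - 3) = 0.
Proof.
move=> p_pr p_odd p5 a; have hE : p.-1 = p.-1./2.*2 by clear a; lia.
suff: a`_3 = 0 /\ a`_(p.-1./2.*2 - 3) = 0 by rewrite -hE.
apply: quadratic_exp_coef3_eq0.
- exact: natr_Fp_half.
- by apply: natr_Fp_neq0 => //; lia.
- have -> : (15 : int)%:~R = 3%:R * 5%:R :> 'F_p by ring.
  by rewrite mulf_neq0 // natr_Fp_neq0 //; lia.
- by apply: natr_Fp_neq0 => //; lia.
- by ring.
- by clear a; lia.
Qed.

Theorem theorem1p3 :
  (forall n : nat, odd n -> (3 < n)%N ->
     (n%:Z ^+ 2 %| jacobi_det 2 3 n)%Z) /\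
  (forall n : nat, odd n -> (5 < n)%N ->
     (n%:Z ^+ 2 %| jacobi_det 6 15 n)%Z).
Proof.
split=> n n_odd n_gt; apply: sqr_dvdz_jacobi_det => //; try by lia.
- move=> p p_pr pn ltpn; have p_odd : odd p by apply: dvdn_odd pn n_odd.
  have := odd_prime_gt2 p_odd p_pr; rewrite leq_eqVlt => /predU1P[<-|p3].
    by left.
  by right; exists 2%N; [lia | have [] := coef_2_3 p_pr p_odd p3].
- move=> n_pr; have [->|n5] := eqVneq n 5%N; first by rewrite jacobi_det_2_3_5 dvdz0.
  have [a2 a2'] := coef_2_3 n_pr n_odd n_gt.
  (* The indices 2 and p - 3 differ because p is not 5. *)
  by apply: sqr_dvdz_jacobi_det_prime a2 a2'; lia.
- move=> p p_pr pn ltpn; have p_odd : odd p by apply: dvdn_odd pn n_odd.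
  have [p5|p5] := ltnP 5 p.
    by right; exists 3%N; [lia | have [] := coef_6_15 p_pr p_odd p5].
  (* Only 3 and 5 remain, and both divide 15. *)
  left; have := odd_prime_gt2 p_odd p_pr.
  by case: p p_odd p5 {p_pr pn ltpn} => [|[|[|[|[|[|p]]]]]].
move=> n_pr; have [->|n7] := eqVneq n 7%N; first by rewrite jacobi_det_6_15_7 dvdz0.
have [a3 a3'] := coef_6_15 n_pr n_odd n_gt.
(* The indices 3 and p - 4 differ because p is not 7. *)
by apply: sqr_dvdz_jacobi_det_prime a3 a3'; lia.
Qed.
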